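(* Let $A\subset\mathbb{Z}$ be a fixed finite nonempty set with characteristic function $\chi_A$, and let $1\leq p\leq\infty$ be fixed, with dual exponent $p'$. Let $c$ be the absolute constant of the Borwein-Erdélyi bound, i.e. an absolute constant $c>0$ such that for every arc $E\subset\mathbb{T}$, $$\inf_{P\in\mathcal{F}\setminus\{0\}}\|P\|_{L^\infty(E)}\geq e^{-c/|E|}.$$ Then for all integers $k$ large enough depending on $|A|$, $$\|\chi_A^{(k)}\|_{l^p(\mathbb{Z})}\geq 2^{\,k-1-3(\log_2 e)\left(\frac{c\pi}{4}\right)^{2/3}k^{1/3}}\big[(k+1)|A|\big]^{-\frac{1}{p'}}.$$
   Context: For $f:\mathbb{Z}\to\mathbb{R}$ and an integer $k\geq 1$, the discrete derivative (forward difference) of order $k$ is $f^{(k)}(n):=\sum_{j=0}^{k}\binom{k}{j}(-1)^{j}f(n+k-j)$, $n\in\mathbb{Z}$. $\mathbb{T}=\mathbb{R}/\mathbb{Z}$ is the torus of total measure $1$, identified with the unit circle through $z=e^{2\pi i x}$, and $|E|$ is the measure (length) of the arc $E$ in this normalization. $\mathcal{F}$ is the set of all polynomials $\sum_{j=0}^{n}a_jz^j$, of any degree $n$, with coefficients $a_j\in\{-1,0,1\}$. The existence of an absolute constant $c$ with the displayed property is a known theorem of Borwein and Erdélyi. The dual exponent $p'$ satisfies $\frac1p+\frac1{p'}=1$, with $1/\infty=0$. *)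

(* Defs.v *)
From HB Require Import structures.
From mathcomp Require Import all_boot all_order all_algebra finmap.
From mathcomp Require Import complex.
From mathcomp Require Import all_classical all_reals all_analysis.

Set Implicit Arguments.
Unset Strict Implicit.
Unset Printing Implicit Defensive.

Import Order.TTheory GRing.Theory Num.Theory.
Import numFieldNormedType.Exports.

Local Open Scope classical_set_scope.
Local Open Scope ring_scope.

(* The discrete sigma-algebra on the integers, so that l^p(Z) is L^p of the
   counting measure on int. *)
HB.instance Definition _ := isPointed.Build int 0.
HB.instance Definition _ := @isMeasurable.Build default_measure_display
  int discrete_measurable discrete_measurable0
  discrete_measurableC discrete_measurableU.

Definition lp_norm (R : realType) (p : \bar R) (f : int -> R) : \bar R :=
  Lnorm (counting : {measure set int -> \bar R}) p (EFin \o f).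

Definition discrete_derivative (R : realType) (k : nat) (f : int -> R)
    (n : int) : R :=
  \sum_(0 <= j < k.+1) 'C(k, j)%:R * (-1) ^+ j * f (n + k%:Z - j%:Z).

(* The point exp(2 pi i x) of the unit circle. *)
Definition torus_exp (R : realType) (x : R) : R[i] :=
  Complex (cos (2 * pi * x)) (sin (2 * pi * x)).

Definition littlewood (R : realType) : set {poly R[i]} :=
  [set P : {poly R[i]} | forall j : nat, P`_j \in [:: -1; 0; 1]].

(* The L^oo norm of P on the arc {exp(2 pi i x) | a <= x <= b}, computed on the
   lift [a, b] of the arc with Lebesgue measure; for a < b <= a + 1 the length of
   the arc in R/Z is b - a.  Being an essential supremum, it does not depend on
   whether the end points belong to the arc. *)
Definition arc_Linfty_norm (R : realType) (a b : R) (P : {poly R[i]}) : \bar R :=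
  Lnorm (mrestr lebesgue_measure (measurable_itv `[a, b])) +oo%E
    (fun x : R => (Normc.normc P.[torus_exp x])%:E).

Definition borwein_erdelyi_constant (R : realType) (c : R) : Prop :=
  forall a b : R, a < b -> b <= a + 1 ->
    ((expR (- (c / (b - a))))%:E <=
     ereal_inf [set arc_Linfty_norm a b P | P in @littlewood R `\ 0%R])%E.

Definition log2 (R : realType) (x : R) : R := ln x / ln 2.

(* Main.v *)
Require Import Defs.
From mathcomp Require Import all_boot all_order all_algebra finmap.
From mathcomp Require Import all_classical all_reals all_analysis.
From mathcomp Require Import complex ess_sup_inf measurable_realfun.
From mathcomp Require Import zify ring lra.

Import Order.TTheory GRing.Theory Num.Theory.
Import numFieldNormedType.Exports.

Local Open Scope classical_set_scope.
Local Open Scope ring_scope.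

(** The Fourier series of the k-th difference of f = \chi_A is that of f times
(1 - z)^k, up to a factor of modulus 1. Since |1 - z| = 2 |sin (pi x)| is close
to its maximum 2 near z = -1, the sum of |f^(k)| is at least
|F(z)| |1 - z|^k for every z on a short arc E centred at -1, where
F = \sum_(a in A) z^a. On E the factor |1 - z|^k is at least
(2 exp (- y^2))^k, with y = pi |E| / 2. After a shift of A, F is a nonzero
polynomial with coefficients 0 and 1, so the Borwein-Erdelyi hypothesis says
that |F| is not uniformly smaller than exp (- c / |E|) on E. Hence
  ||f^(k)||_1 >= 2^k exp (- (k y^2 + c pi / (2 y))),
and the choice y^3 = c pi / (4 k), which minimizes k y^2 + c pi / (2 y),
turns this sum into 3 (c pi / 4)^(2/3) k^(1/3). The bound before the choice of
y is [derivative_indic_l1_ge]. The estimate of |1 - z| needs y <= 1/2, that is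
k >= 2 c pi: this is the threshold on k.

The passage from l^1 to l^p is Hoelder's inequality on the support of f^(k),
which consists of at most (k + 1) |A| integers ([lp_norm_derivative_ge_l1]).

No integration on the circle is needed: shifting the finite support of f to the
natural numbers makes f^(k) the coefficient sequence of the polynomial
P (1 - X)^k, where P has the values of f as coefficients
([coef_window_poly_derivative]), and a polynomial is bounded on the unit circle
by the sum of the moduli of its coefficients. *)

(** * Comparison of the l^1 and l^p norms by the size of the support *)

Lemma Lnorm_indic d (T : measurableType d) (R : realType)
    (mu : {measure set T -> \bar R}) (D : set T) (r : R) :
  measurable D -> r != 0 ->
  (Lnorm mu r%:E (EFin \o \1_D) = mu D `^ r^-1)%E.
Proof.
move=> mD r0; rewrite unlock; congr (_ `^ _)%E.
rewrite -[X in _ = mu X]setIT.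
rewrite -integral_indic//; apply: eq_integral => x _ /=.
rewrite indicE; case: (x \in D) => /=; first by rewrite normr1 powR1.
by rewrite normr0 powR0.
Qed.

(** Hoelder's inequality for the product of f and the indicator of D, with the
end points p = 1 and p = +oo, where the conjugate exponent is +oo or 1, checked
directly. *)
Lemma Lnorm1_le_Lnorm_support d (T : measurableType d) (R : realType)
    (mu : {measure set T -> \bar R}) (D : set T) (f : T -> R) (p : \bar R) :
  measurable D -> measurable_fun [set: T] f -> (forall x, ~ D x -> f x = 0) ->
  (1 <= p)%E ->
  (Lnorm mu 1 (EFin \o f)
   <= Lnorm mu p (EFin \o f) * mu D `^ fine (hoelder_conjugate p)^-1)%E.
Proof.
move=> mD mf f0 p1.
have fD : f = f \* \1_D.
  apply/funext => x /=; rewrite indicE.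
  have [xD|xD] := boolP (x \in D); first by rewrite mulr1.
  by rewrite mulr0 f0// => /mem_set; exact/negP.
case: p p1 => [r|_|//].
- rewrite lee_fin le_eqVlt => /predU1P[<-|r1].
    by rewrite hoelder_conjugate1 invey poweRe0 mule1.
  have r0 : 0 < r by apply: lt_trans r1.
  have q0 : 0 < r / (r - 1) by rewrite divr_gt0// subr_gt0.
  have pq : r^-1 + (r / (r - 1))^-1 = 1.
    by rewrite invf_div -{1}(div1r r) -mulrDl subrKC mulfV// gt_eqF.
  have -> : fine (hoelder_conjugate r%:E)^-1 = (r / (r - 1))^-1.
    rewrite /hoelder_conjugate/= gt_eqF ?lte_fin// -EFinB inver subr_eq0.
    by rewrite gt_eqF// -EFinM inver gt_eqF.
  rewrite -Lnorm_indic ?gt_eqF// [in leLHS]fD.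
  exact: (hoelder mu mf (measurable_indic mD) r0 q0 pq).
- rewrite hoelder_conjugatey inve1 /= poweRe1//.
  have mEf : measurable_fun [set: T] (EFin \o f) by exact/measurable_EFinP.
  (* For p = +oo the norm is an essential supremum when mu has positive mass,
     and 0 by convention otherwise. *)
  rewrite Lnorm1 [in leRHS]unlock; case: ifPn => [muT|].
    rewrite -integral_cst//.
    rewrite [leLHS](_ : _ = \int[mu]_(x in D) `|(EFin \o f) x|)%E.
      apply: ae_ge0_le_integral => //.
      - by apply: measurable_funTS; exact: measurableT_comp.
      - move=> x _; apply: ess_sup_gee => //.
        by apply/nearW => z; exact: abse_ge0.
      - by apply: filterS (ess_sup_ge mu (abse \o (EFin \o f))) => x.
    rewrite [RHS]integral_mkcond; apply: eq_integral => x _; rewrite patchE.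
    by case: ifPn => // xD; rewrite /= f0 ?normr0// => /mem_set; exact/negP.
  rewrite -leNgt => muT; rewrite integral_abs_eq0 ?mul0e//.
  by apply/eqP; rewrite eq_le muT measure_ge0.
Qed.

(** As s has no repetition, |g| dominates the simple function
\sum_(n <- s) |g n| \1_{n}, whose integral is the sum. *)
Lemma sum_norm_le_l1_norm (R : realType) (g : int -> R) (s : seq int) :
  uniq s -> ((\sum_(n <- s) `|g n|)%:E <= lp_norm 1 g)%E.
Proof.
move=> us; have mint (f : int -> \bar R) : measurable_fun [set: int] f by [].
rewrite /lp_norm Lnorm1.
have -> : (\sum_(n <- s) `|g n|)%:E =
    (\int[counting]_x \sum_(n <- s) `|g n|%:E * (\1_[set n] x)%:E)%E.
  rewrite ge0_integral_sum//.
  rewrite -sumEFin; apply: eq_bigr => n _.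
  rewrite ge0_integralZl// integral_indic// setIT /= /counting asboolT//.
  by rewrite fset_set1 cardfs1 mule1.
apply: ge0_le_integral => //.
  by move=> x _; apply: sume_ge0 => n _; rewrite mule_ge0// lee_fin.
move=> x _ /=; have [xs|xs] := boolP (x \in s).
  rewrite (bigD1_seq x)//= indicE mem_set// mule1 big1 ?adde0// => n nx.
  by rewrite indicE memNset ?mule0// => /= xn; rewrite xn eqxx in nx.
rewrite big_seq big1 ?lee_fin// => n ns.
by rewrite indicE memNset ?mule0// => /= xn; rewrite xn ns in xs.
Qed.

Lemma counting_seq_le (R : realType) (s : seq int) :
  ((counting [set` s] : \bar R) <= (size s)%:R%:E)%E.
Proof.
rewrite /counting asboolT; last exact: finite_seq.
have -> : [set` s] = [set` [fset x in s]%fset].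
  by apply/seteqP; split=> x /=; rewrite inE.
by rewrite set_fsetK card_fseq lee_fin ler_nat size_undup.
Qed.

(** The difference at n only involves the values at n, ..., n + k, hence
vanishes unless n = a - k + j for some a in A and j <= k: at most (k + 1) |A|
values. *)
Lemma lp_norm_derivative_ge_l1 (R : realType) (A : {fset int}) (k : nat)
    (p : \bar R) : (1 <= p)%E ->
  (lp_norm 1 (discrete_derivative k (\1_[set` A] : int -> R)) <=
   lp_norm p (discrete_derivative k (\1_[set` A] : int -> R)) *
   ((k.+1%:R * #|` A|%:R) `^ fine (hoelder_conjugate p)^-1)%:E)%E.
Proof.
move=> p1; set g := discrete_derivative _ _.
pose s := [seq a - k%:Z + j%:Z | a <- enum_fset A, j <- iota 0 k.+1].
have gs n : ~ [set` s] n -> g n = 0.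
  move=> ns; rewrite /g /discrete_derivative big_nat big1// => j /andP[_ jk].
  rewrite indicE memNset ?mulr0//= => nA; apply: ns => /=.
  apply/allpairsP; exists (n + k%:Z - j%:Z, j).
  split; [exact: nA|by rewrite mem_iota|].
  by rewrite /=; ring.
apply: le_trans
  (@Lnorm1_le_Lnorm_support _ _ _ counting [set` s] g p _ _ gs p1) _ => //.
apply: lee_wpmul2l; first exact: Lnorm_ge0.
rewrite -poweR_EFin; apply: gt0_ler_poweR.
- by apply: fine_ge0; rewrite inve_ge0 (le_trans _ (hoelder_conj_ge1 p1)).
- by rewrite in_itv /= measure_ge0 leey.
- by rewrite in_itv /= lee_fin mulr_ge0 ?leey.
apply: le_trans (counting_seq_le _ _) _.
by rewrite size_allpairs size_iota lee_fin mulnC natrM.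
Qed.

(** * The factor 1 - z near z = -1 *)

Lemma norm_sin_le (R : realType) (x : R) : `|sin x| <= `|x|.
Proof.
wlog x0 : x / 0 <= x => [H|].
  have [/H//|/ltW x0] := leP 0 x.
  by rewrite -(normrN x) -(normrN (sin x)) -sinN H// oppr_ge0.
have [t _] := @MVT_segment R sin cos 0 x x0
  (fun t _ => is_derive_sin t) (continuous_subspaceT (@continuous_sin R)).
rewrite sin0 !subr0 => ->; rewrite normrM -[leRHS]mul1r ler_wpM2r//.
exact: cos_max.
Qed.

Lemma cos_ge_quadratic (R : realType) (x : R) : 1 - x ^+ 2 / 2 <= cos x.
Proof.
have -> : cos x = 1 - 2 * sin (x / 2) ^+ 2.
  by rewrite {1}(splitr x) -mulr2n cos_mulr2n cos2sin2; ring.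
have := norm_sin_le _ (x / 2).
rewrite -ler_sqr ?nnegrE// !real_normK ?num_real//.
lra.
Qed.

(** Since exp (2 t) >= 1 + 2 t, it suffices that (1 + 2 t) (1 - t) >= 1, which
holds exactly for t in [0, 1/2]. *)
Lemma expR_le_1B (R : realType) (t : R) : 0 <= t -> t <= 1 / 2 ->
  expR (- (2 * t)) <= 1 - t.
Proof.
move=> t0 t1; rewrite expRN -[leRHS]invrK lef_pV2 ?posrE ?invr_gt0 ?expR_gt0//.
  apply: le_trans (expR_ge1Dx _).
  rewrite -div1r ler_pdivrMr; nra.
by lra.
Qed.

Lemma normc_torus_exp (R : realType) (x : R) : Normc.normc (torus_exp x) = 1.
Proof. by rewrite /= cos2Dsin2 sqrtr1. Qed.

(** With z = - exp (i t) and |t| <= 2 y, one has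
|1 - z|^2 = 2 + 2 cos t >= 4 - t^2 >= 4 (1 - y^2) >= 4 exp (- 2 y^2). *)
Lemma normc_1B_torus_exp (R : realType) (x y : R) :
  y <= 1 / 2 -> pi * `|x - 1 / 2| <= y ->
  2 * expR (- y ^+ 2) <= Normc.normc (1 - torus_exp x).
Proof.
move=> y1 xy.
have y0 : 0 <= y by apply: le_trans xy; rewrite mulr_ge0// pi_ge0.
have -> : Normc.normc (1 - torus_exp x) = Num.sqrt (2 - 2 * cos (2 * pi * x)).
  rewrite /torus_exp /=; set t := 2 * pi * x; congr Num.sqrt.
  rewrite (_ : _ + _ = 1 - 2 * cos t + cos t ^+ 2 + sin t ^+ 2); last by ring.
  by rewrite sin2cos2; ring.
have cosx : cos (2 * pi * x) = - cos (2 * (pi * (x - 1 / 2))).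
  rewrite -[RHS]cosDpi; congr cos; by field.
have phi : (pi * (x - 1 / 2)) ^+ 2 <= y ^+ 2.
  rewrite -real_normK ?num_real// ler_sqr ?nnegrE//.
  by rewrite normrM ger0_norm// pi_ge0.
have e1 : expR (- y ^+ 2) ^+ 2 <= 1 - y ^+ 2.
  by rewrite -expRM_natl mulrN expR_le_1B ?sqr_ge0//; nra.
have := cos_ge_quadratic _ (2 * (pi * (x - 1 / 2))).
rewrite cosx exprMn => c1.
rewrite -ler_sqr ?nnegrE ?mulr_ge0 ?expR_ge0 ?sqrtr_ge0//.
rewrite sqr_sqrtr ?exprMn; nra.
Qed.

(** * Differences as coefficients of a product of polynomials *)

Lemma normcX (R : rcfType) (z : R[i]) (n : nat) :
  Normc.normc (z ^+ n) = Normc.normc z ^+ n.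
Proof.
by elim: n => [|n ih]; rewrite ?Normc.normc1// !exprS Normc.normcM ih.
Qed.

Lemma normc_real (R : rcfType) (x : R) : Normc.normc x%:C%C = `|x|.
Proof. by rewrite /= expr0n addr0 sqrtr_sqr. Qed.

Lemma normc_horner_le (R : rcfType) (Q : {poly R[i]}) (z : R[i]) :
  Normc.normc z = 1 ->
  Normc.normc Q.[z] <= \sum_(i < size Q) Normc.normc Q`_i.
Proof.
move=> z1; rewrite horner_coef.
elim/big_ind2 : _ => [|a b c d ab cd|i _]; first by rewrite Normc.normc0.
  exact: le_trans (le_normcD _ _) (lerD ab cd).
by rewrite Normc.normcM normcX z1 expr1n mulr1.
Qed.

(** The generating polynomial of f on the window [m, m + N): the Fourier series
of f up to the factor z^m when f is supported in the window. *)
Definition window_poly {R : realType} (m : int) (N : nat) (f : int -> R) :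
  {poly R[i]} := \poly_(i < N) (f (m + i%:Z))%:C%C.

Lemma coef_window_poly (R : realType) (m : int) (N : nat) (f : int -> R)
    (i : nat) :
  (forall n, f n != 0 -> m <= n < m + N%:Z) ->
  (window_poly m N f)`_i = (f (m + i%:Z))%:C%C.
Proof.
move=> fN; rewrite coef_poly; case: ltnP => // Ni.
have [->//|/fN] := eqVneq (f (m + i%:Z)) 0.
by lia.
Qed.

(** Expanding (1 - X)^k binomially, the multiplication by X^j shifts f by j;
the index is offset by k because the forward difference looks at
n, ..., n + k while the product looks at i - k, ..., i. *)
Lemma coef_window_poly_derivative (R : realType) (m : int) (N k : nat)
    (f : int -> R) (i : nat) :
  (forall n, f n != 0 -> m <= n < m + N%:Z) ->
  (window_poly m N f * (1 - 'X) ^+ k)`_i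
    = (discrete_derivative k f (m - k%:Z + i%:Z))%:C%C.
Proof.
move=> fN; rewrite exprBn mulr_sumr coef_sum /discrete_derivative big_mkord.
rewrite rmorph_sum; apply: eq_bigr => j _ /=.
rewrite expr1n mulr1 mulrnAr coefMn.
have -> : (-1 : {poly R[i]}) ^+ j = ((-1) ^+ j)%:P.
  by rewrite rmorphXn/= rmorphN1.
rewrite mulrCA coefCM coefMXn.
have -> : (if (i < j)%N then 0 else (window_poly m N f)`_(i - j)) =
   (f (m - k%:Z + i%:Z + k%:Z - j%:Z))%:C%C.
  have -> : m - k%:Z + i%:Z + k%:Z - j%:Z = m + (i%:Z - j%:Z) by ring.
  (* When j > i the index m + i - j lies to the left of the window, where f
     vanishes, and a multiple of 'X^j has no coefficient of index i. *)
  case: ltnP => ij; last by rewrite coef_window_poly// subzn.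
  have [->//|/fN] := eqVneq (f (m + (i%:Z - j%:Z))) 0; first by lia.
rewrite !rmorphM /= rmorph_nat rmorphXn /= rmorphN1.
by rewrite -[LHS]mulr_natl mulrA.
Qed.

(** * The lower bound for the l^1 norm *)

Lemma arc_Linfty_norm_le (R : realType) (a b M : R) (P : {poly R[i]}) :
  0 <= M ->
  (forall x, a <= x <= b -> Normc.normc P.[torus_exp x] <= M) ->
  (arc_Linfty_norm a b P <= M%:E)%E.
Proof.
move=> M0 PM; rewrite /arc_Linfty_norm unlock; case: ifPn => [_|_]; last first.
  by rewrite lee_fin.
apply/ess_supP; exists (~` [set` `[a, b]]); split.
- by apply: measurableC; exact: measurable_itv.
- by rewrite /= /mrestr setICl measure0.
- move=> x /= + /[!in_itv]/= xab; apply; rewrite lee_fin ger0_norm ?PM//.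
  by case: (P.[_]) => u v; exact: sqrtr_ge0.
Qed.

Lemma fset_int_bounded (A : {fset int}) :
  exists M : nat, forall n, n \in A -> (`|n| <= M)%N.
Proof.
exists (\max_(n <- A) `|n|)%N => n nA.
exact: leq_bigmax_seq.
Qed.

(** The arc is [1/2 - y/pi, 1/2 + y/pi], of length 2 y / pi and centred at
z = -1. A bound l on |P (1 - X)^k| over the unit circle bounds |P| on the arc by
l / (2 exp (- y^2))^k, while P is a nonzero polynomial with coefficients 0 and
1, so this cannot be less than exp (- c / (2 y / pi)). *)
Lemma derivative_indic_l1_ge (R : realType) (c : R) (A : {fset int}) (k : nat)
    (y : R) :
  borwein_erdelyi_constant c -> A != fset0 -> 0 < y -> y <= 1 / 2 ->
  ((expR (- (c * pi / (2 * y))) * (2 * expR (- y ^+ 2)) ^+ k)%:E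
   <= lp_norm 1 (discrete_derivative k (\1_[set` A] : int -> R)))%E.
Proof.
move=> cBE /fset0Pn[a0 a0A] y0 y12; have [M AM] := fset_int_bounded A.
have pi0 := pi_gt0 R; have pi2 := pi_ge2 R.
set f : int -> R := \1_[set` A].
(* A lies in the window [m, m + N), so no coefficient is lost in P. *)
set m : int := - M%:Z; set N := M.*2.+1.
have fN n : f n != 0 -> m <= n < m + N%:Z.
  rewrite /f indicE; case: (boolP (n \in _)) => [|_]; last by rewrite eqxx.
  by rewrite inE /= => /AM; rewrite /m /N; lia.
set P := window_poly m N f; set Q := P * (1 - 'X) ^+ k.
set a : R := 1 / 2 - y / pi; set b : R := 1 / 2 + y / pi.
have ypi : 0 < y / pi by rewrite divr_gt0.
have ypi2 : y / pi <= 1 / 4 by rewrite ler_pdivrMr//; lra.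
have littlewoodP : P \in (@littlewood R `\ 0%R).
  rewrite inE; split=> [j|/(congr1 (fun q : {poly R[i]} => q`_(`|a0 - m|)))].
    rewrite coef_window_poly// /f indicE.
    by case: (_ \in _); rewrite !inE eqxx ?orbT.
  rewrite coef0 coef_window_poly// /f indicE.
  have -> : m + `|a0 - m|%:Z = a0 by have := AM _ a0A; rewrite /m; lia.
  by rewrite mem_set//= => -[/eqP]; rewrite oner_eq0.
set l : R := \sum_(i < size Q) Normc.normc Q`_i.
have e0 : 0 < (2 * expR (- y ^+ 2)) ^+ k.
  by rewrite exprn_gt0// mulr_gt0// expR_gt0.
(* On the arc, |P| (2 exp(-y^2))^k <= |P| |1 - z|^k = |Q| <= l. *)
have arcP : (arc_Linfty_norm a b P <= (l / (2 * expR (- y ^+ 2)) ^+ k)%:E)%E.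
  apply: arc_Linfty_norm_le => [|x xab].
    rewrite divr_ge0 ?(ltW e0)//.
    by apply: sumr_ge0 => i _; case: (Q`_i) => u v; exact: sqrtr_ge0.
  rewrite ler_pdivlMr//.
  apply: le_trans (normc_horner_le _ Q _ (normc_torus_exp _ x)).
  rewrite /Q hornerM horner_exp !hornerE Normc.normcM normcX ler_wpM2l//.
    by case: (P.[_]) => u v; exact: sqrtr_ge0.
  rewrite lerXn2r// ?nnegrE ?mulr_ge0 ?expR_ge0//; first exact: sqrtr_ge0.
  apply: normc_1B_torus_exp => //.
  rewrite -ler_pdivlMl// mulrC ler_norml.
  by move: xab; rewrite /a /b; lra.
have cab :
    ((expR (- (c / (b - a))))%:E <= (l / (2 * expR (- y ^+ 2)) ^+ k)%:E)%E.
  apply: le_trans arcP; apply: le_trans (cBE a b _ _) _.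
  - by rewrite /a /b; lra.
  - by rewrite /a /b; lra.
  - by apply: ereal_inf_lbound; exists P; first exact/set_mem.
have baE : c / (b - a) = c * pi / (2 * y).
  by rewrite (_ : b - a = 2 * y / pi) ?invf_div ?mulrA// /a /b; ring.
have lE : l = \sum_(n <- [seq m - k%:Z + i%:Z | i <- iota 0 (size Q)])
                 `|discrete_derivative k f n|.
  rewrite big_map -[X in iota 0 X]subn0 -/(index_iota 0 _) big_mkord.
  apply: eq_bigr => i _; by rewrite coef_window_poly_derivative// normc_real.
apply: (@le_trans _ _ l%:E).
  by move: cab; rewrite !lee_fin baE ler_pdivlMr.
rewrite lE; apply: sum_norm_le_l1_norm.
by rewrite map_inj_uniq ?iota_uniq// => i j /addrI [].
Qed.

(** * The lower bound for the l^p norm *)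

Theorem theorem4 (R : realType) (c : R) (c_gt0 : 0 < c)
    (c_BE : borwein_erdelyi_constant c) :
  exists K : nat -> nat,
    forall (A : {fset int}) (p : \bar R), A != fset0 -> (1 <= p)%E ->
    forall k : nat, (1 <= k)%N -> (K #|` A| <= k)%N ->
      ((2 `^ (k%:R - 1
              - 3 * log2 (expR 1) * (c * pi / 4) `^ (2 / 3) * k%:R `^ (1 / 3))
        * ((k.+1)%:R * #|` A|%:R) `^ (- fine (hoelder_conjugate p)^-1%E))%:E
       <= lp_norm p (discrete_derivative k \1_[set` A]))%E.
Proof.
exists (fun=> Num.bound (2 * c * pi)) => A p A0 p1 k k1 Kk.
have pi0 := pi_gt0 R; have k0 : 0 < k%:R :> R by rewrite ltr0n.
(* Since y^3 will be c pi / (4 k), this amounts to y <= 1/2. *)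
have kc : 2 * c * pi <= k%:R.
  apply: ltW; apply: lt_le_trans (archi_boundP _) _; last by rewrite ler_nat.
  by rewrite !mulr_ge0// ltW.
have cp0 : 0 < c * pi / 4 by rewrite divr_gt0// mulr_gt0.
set u := (c * pi / 4) `^ (1 / 3); set v : R := k%:R `^ (1 / 3).
have u0 : 0 < u by exact: powR_gt0.
have v0 : 0 < v by exact: powR_gt0.
have u3 : u ^+ 3 = c * pi / 4.
  rewrite -powR_mulrn ?ltW// -powRrM (_ : 1 / 3 * 3%:R = 1); last by field.
  by rewrite powRr1// ltW.
have v3 : v ^+ 3 = k%:R.
  rewrite -powR_mulrn ?ltW// -powRrM (_ : 1 / 3 * 3%:R = 1); last by field.
  by rewrite powRr1// ltW.
have u2 : (c * pi / 4) `^ (2 / 3) = u ^+ 2.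
  rewrite -powR_mulrn ?ltW// -powRrM; congr (_ `^ _); by field.
rewrite u2.
set y := u / v.
(* y minimizes k y^2 + c pi / (2 y): it satisfies k y^3 = c pi / 4, so the two
   terms below are u^2 v and 2 u^2 v. *)
have y0 : 0 < y by rewrite divr_gt0.
have y12 : y <= 1 / 2.
  rewrite ler_pdivrMr// -(@ler_pXn2r _ 3)// ?nnegrE;
    rewrite ?mulr_ge0 ?(ltW u0) ?(ltW v0)//.
  by rewrite exprMn u3 v3; lra.
have ky2 : k%:R * y ^+ 2 = u ^+ 2 * v.
  by rewrite -v3 /y; field; rewrite gt_eqF.
have cy : c * pi / (2 * y) = 2 * (u ^+ 2 * v).
  rewrite (_ : c * pi = 4 * u ^+ 3); last by rewrite u3; field.
  by rewrite /y; field; rewrite !gt_eqF.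
have ln20 : 0 < ln 2 :> R by rewrite ln_gt0// ltr1n.
have main : 2 `^ (k%:R - 1 - 3 * log2 (expR 1) * u ^+ 2 * v)
    <= expR (- (c * pi / (2 * y))) * (2 * expR (- y ^+ 2)) ^+ k.
  rewrite exprMn -expRM_natl mulrN ky2 cy [leRHS]mulrCA -expRD.
  rewrite -(@powR_mulrn _ 2)//.
  rewrite /powR pnatr_eq0/= -expRD ler_expR /log2 expRK.
  (* The exponents differ by the contribution of the term - 1 on the left. *)
  rewrite -subr_ge0 (_ : _ - _ = ln 2); first exact: ltW.
  by field; rewrite gt_eqF.
have := le_trans (derivative_indic_l1_ge _ _ _ k _ c_BE A0 y0 y12)
  (lp_norm_derivative_ge_l1 _ A k p p1).
have W0 : 0 < k.+1%:R * #|` A|%:R :> R.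
  by rewrite mulr_gt0// ltr0n// cardfs_gt0.
set W := _ `^ _; have {}W0 : 0 < W by exact: powR_gt0.
move=> h; rewrite powRN -/W EFinM lee_pdivrMr//.
by apply: le_trans h; rewrite lee_fin.
Qed.
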